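(* Let $\mathfrak E$ be a tropical toric vector bundle with matroid $\mathcal M$ over a smooth, complete toric variety $X_\Sigma$. Then $\mathfrak E$ is globally generated if and only if for each maximal cone $\sigma\in\Sigma$ there is a basis $B\subset\mathcal M$ such that the characters $u_{\sigma,1},\dots,u_{\sigma,r}$ of $\mathfrak E$ at $\sigma$ (as a multiset) are the vertices in the $\sigma$ direction of the polyhedra $P_{\mathfrak v(e)}$, $e\in B$.
   Context: $N\cong\mathbb Z^d$ is a lattice with dual lattice $M$; $\Sigma$ is a smooth complete fan in $N_{\mathbb R}$; $\mathbf v_\rho$ is the primitive generator of a ray $\rho$; $\sigma(1)$ is the set of rays of $\sigma$. $\mathcal M$ is a loop-free matroid of rank $r$ on $\{1,\dots,m\}$. $\operatorname{Berg}(\mathcal M)\subset\mathbb R^m$ is the set of $w$ such that for every circuit $C$ the minimum $\min_{i\in C}w_i$ is attained at least twice (equivalently, all sets $\{i:w_i\ge t\}$ are flats). For a basis $B$, the apartment $A_B$ is the set of $w\in\operatorname{Berg}(\mathcal M)$ for which $\sum_{b\in B}w_b$ is maximal among all bases; projection to the $B$-coordinates identifies $A_B$ with $\mathbb R^B$. A tropical toric vector bundle $\mathfrak E$ over $X_\Sigma$ with matroid $\mathcal M$ is a map $\Phi:N_{\mathbb R}\to\operatorname{Berg}(\mathcal M)$ with $\Phi(N)\subset\mathbb Z^m$ such that for each $\sigma\in\Sigma$ there is a basis $B_\sigma$ with $\Phi(\sigma)\subset A_{B_\sigma}$ and $\Phi|_\sigma$, in the coordinates $\mathbb R^{B_\sigma}$,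 the restriction of a linear map. Write $\mathfrak v(e)(x)=\Phi(x)_e$. For $\sigma$ maximal, the characters of $\mathfrak E$ at $\sigma$ are the multiset $\{\mathfrak v(b)|_\sigma:b\in B_\sigma\}\subset M$, which does not depend on the choice of $B_\sigma$. $P_{\mathfrak v(e)}=\{y\in M_{\mathbb R}:\langle y,\mathbf v_\rho\rangle\le\mathfrak v(e)(\mathbf v_\rho)\ \forall\rho\in\Sigma(1)\}$. For a maximal cone $\sigma$, $u$ is the vertex of $P_{\mathfrak v(e)}$ in the $\sigma$ direction if $u\in P_{\mathfrak v(e)}$ and $\langle u,\mathbf v_\rho\rangle=\mathfrak v(e)(\mathbf v_\rho)$ for all $\rho\in\sigma(1)$ (such a $u$ need not exist). For a ray $\rho$ and $k\in\mathbb Z$ let $F^\rho_k=\{e\in\mathcal M:\mathfrak v(e)(\mathbf v_\rho)\ge k\}$, a flat. For $u\in M$ let $H^0(X_\Sigma,\mathfrak E)_u=\{e\in\mathcal M:u\in P_{\mathfrak v(e)}\}=\bigcap_{\rho}F^\rho_{\langle u,\mathbf v_\rho\rangle}$. For a maximal cone $\sigma$ with rays $\rho_1,\dots,\rho_d$ and $\mathbf r\in\mathbb Z^d$ put $F_{\mathbf r}=F^{\rho_1}_{r_1}\cap\dots\cap F^{\rho_d}_{r_d}$ and $F_{>\mathbf r}=\operatorname{span}\big(\bigcup_{i=1}^dF^{\rho_1}_{r_1}\cap\dots\cap F^{\rho_i}_{r_i+1}\cap\dots\cap F^{\rho_d}_{r_d}\big)$ (span = matroid closure). The matroid fiber is the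 direct sum of quotient (contraction) matroids $\mathfrak E_\sigma=\bigoplus_{\mathbf r\in\mathbb Z^d}F_{\mathbf r}/F_{>\mathbf r}$. $\mathfrak E$ is globally generated if for every maximal $\sigma$ the elements of $\mathfrak E_\sigma$ given by the pairs $(e,u)$ with $u\in M$, $e\in H^0(X_\Sigma,\mathfrak E)_u$ and $e\notin F_{>\mathbf r}$, where $\mathbf r=(\langle u,\mathbf v_{\rho_i}\rangle)_i$ (placed in the summand indexed by $\mathbf r$), contain a basis of $\mathfrak E_\sigma$. *)

(* Defs.v *)
From mathcomp Require Import all_boot all_order all_algebra.
From mathcomp Require Import boolp classical_sets cardinality reals.

Set Implicit Arguments.
Unset Strict Implicit.
Unset Printing Implicit Defensive.

Import Order.TTheory GRing.Theory Num.Theory.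
Local Open Scope ring_scope.

(** * Matroids *)

(* The ground set is a field, not the whole of [T], so that restrictions and
   contractions are matroids over the same finite type. *)
Record matroid (T : finType) := Matroid {
  ground : {set T};
  indep : pred {set T};
  indep_ground : forall A, indep A -> A \subset ground;
  indep_set0 : indep finset.set0;
  indep_subset : forall A B : {set T}, A \subset B -> indep B -> indep A;
  indep_augment : forall A B : {set T}, indep A -> indep B -> (#|A| < #|B|)%N ->
    exists2 e, e \in B :\: A & indep (e |: A)
}.

Section MatroidTheory.
Variables (T : finType) (M : matroid T).
Implicit Types A B C F G I J : {set T}.

Definition basis B : bool := maxset (indep M) B.

Definition circuit C : bool :=
  minset (fun A => (A \subset ground M) && ~~ indep M A) C.

Definition rank_of A : nat :=
  \max_(I : {set T} | indep M I && (I \subset A)) #|I|.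

Definition rank : nat := rank_of (ground M).

Definition span A : {set T} :=
  [set e in ground M | rank_of (e |: A) == rank_of A].

Definition loop_free : Prop := forall e, e \in ground M -> indep M [set e].

Definition restr_indep F A : bool := indep M A && (A \subset F).

Lemma restr_indep_ground F A : restr_indep F A -> A \subset ground M :&: F.
Proof.
by case/andP=> /indep_ground ? ?; rewrite finset.subsetI; apply/andP.
Qed.

Lemma restr_indep_set0 F : restr_indep F finset.set0.
Proof. by rewrite /restr_indep indep_set0 finset.sub0set. Qed.

Lemma restr_indep_subset F A B :
  A \subset B -> restr_indep F B -> restr_indep F A.
Proof.
move=> sAB /andP[iB sBF].
by rewrite /restr_indep (indep_subset sAB iB) (fintype.subset_trans sAB sBF).
Qed.

Lemma restr_indep_augment F A B :
  restr_indep F A -> restr_indep F B -> (#|A| < #|B|)%N ->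
  exists2 e, e \in B :\: A & restr_indep F (e |: A).
Proof.
move=> /andP[iA sAF] /andP[iB sBF] ltAB.
have [e eBA ieA] := indep_augment iA iB ltAB.
exists e => //.
rewrite /restr_indep ieA finset.subUset finset.sub1set sAF andbT.
by move: eBA; rewrite finset.inE => /andP[_ /(fintype.subsetP sBF)].
Qed.

Definition restr F : matroid T :=
  @Matroid T (ground M :&: F) (restr_indep F) (@restr_indep_ground F)
    (restr_indep_set0 F) (@restr_indep_subset F) (@restr_indep_augment F).

Definition contr_indep G A : bool :=
  (A \subset ground M :\: G) &&
  [exists J : {set T}, maxset (restr_indep G) J && indep M (A :|: J)].

Lemma contr_indep_ground G A : contr_indep G A -> A \subset ground M :\: G.
Proof. by case/andP. Qed.

Lemma contr_indep_set0 G : contr_indep G finset.set0.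
Proof.
rewrite /contr_indep finset.sub0set /=; apply/existsP.
have [J mJ _] := maxset_exists (restr_indep_set0 G).
by exists J; rewrite mJ finset.set0U; case/maxsetP: mJ => /andP[].
Qed.

Lemma contr_indep_subset G A B :
  A \subset B -> contr_indep G B -> contr_indep G A.
Proof.
move=> sAB /andP[sBE /existsP[J /andP[mJ iBJ]]].
rewrite /contr_indep (fintype.subset_trans sAB sBE); apply/existsP; exists J.
by rewrite mJ (indep_subset (finset.setSU J sAB) iBJ).
Qed.

Lemma leq_maxset_restr_indep G J J' :
  maxset (restr_indep G) J -> restr_indep G J' -> (#|J'| <= #|J|)%N.
Proof.
move=> /maxsetP[rJ maxJ] rJ'; rewrite leqNgt; apply/negP => ltJ.
have [e /finset.setDP[_ eNJ] reJ] := restr_indep_augment rJ rJ' ltJ.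
by move: eNJ; rewrite -(maxJ _ reJ (finset.subsetUr _ _)) finset.setU11.
Qed.

Lemma contr_indep_augment G A B :
  contr_indep G A -> contr_indep G B -> (#|A| < #|B|)%N ->
  exists2 e, e \in B :\: A & contr_indep G (e |: A).
Proof.
move=> /andP[sAE /existsP[J /andP[mJ iAJ]]].
move=> /andP[sBE /existsP[J' /andP[mJ' iBJ']]] ltAB.
have /maxsetP[/andP[iJ sJG] maxJ] := mJ.
have /maxsetP[rJ' _] := mJ'; have /andP[_ sJ'G] := rJ'.
have dis (X Y : {set T}) : X \subset ground M :\: G -> Y \subset G ->
    #|X :|: Y| = (#|X| + #|Y|)%N.
  rewrite finset.subsetD => /andP[_ dXG] sYG.
  by apply/eqP; rewrite (leq_card_setU X Y); apply: disjointWr dXG.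
have eqJ : #|J'| = #|J|.
  have /maxsetP[rJ _] := mJ; apply/eqP; rewrite eqn_leq.
  by rewrite (leq_maxset_restr_indep mJ rJ') (leq_maxset_restr_indep mJ' rJ).
have lt : (#|A :|: J| < #|B :|: J'|)%N by rewrite !dis // eqJ ltn_add2r.
have [e /finset.setDP[eBJ' eNAJ] ieAJ] := indep_augment iAJ iBJ' lt.
have eNG : e \notin G.
  apply/negP => eG; move: eNAJ.
  rewrite finset.in_setU negb_or => /andP[_ /negP]; apply.
  have reJ : restr_indep G (e |: J).
    rewrite /restr_indep finset.subUset finset.sub1set eG sJG !andbT.
    exact: indep_subset (finset.setUS _ (finset.subsetUr _ _)) ieAJ.
  by rewrite -(maxJ _ reJ (finset.subsetUr _ _)) finset.setU11.
have eB : e \in B.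
  move: eBJ'; rewrite finset.in_setU => /orP[//|/(fintype.subsetP sJ'G)].
  by rewrite (negPf eNG).
have eNA : e \notin A by move: eNAJ; rewrite finset.in_setU negb_or => /andP[].
exists e; first by rewrite finset.in_setD eNA.
rewrite /contr_indep finset.subUset finset.sub1set sAE.
rewrite (fintype.subsetP sBE) //=.
by apply/existsP; exists J; rewrite mJ -finset.setUA.
Qed.

Definition contr G : matroid T :=
  @Matroid T (ground M :\: G) (contr_indep G) (@contr_indep_ground G)
    (contr_indep_set0 G) (@contr_indep_subset G) (@contr_indep_augment G).

End MatroidTheory.

(* The quotient matroid F/G of the restriction of M to F by a subset G. *)
Definition quotient_matroid (T : finType) (M : matroid T) (F G : {set T}) :
  matroid T := contr (restr M F) G.

(* The direct sum of a possibly infinite family of matroids has elements the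
   pairs (i, e) with e an element of the i-th summand; a set of pairs is
   independent when all its slices are. *)
Section DirectSum.
Variables (K : Type) (T : finType) (N : K -> matroid T).

Definition dsum_indep (A : set (K * T)) : Prop :=
  forall i, indep (N i) [set e | `[< A (i, e) >] ]%SET.

Definition dsum_basis (A : set (K * T)) : Prop :=
  dsum_indep A /\
  forall A', dsum_indep A' -> (A `<=` A')%classic -> A' = A.

End DirectSum.

(** * Lattices, cones and fans *)

(* N is the lattice of integer row vectors and M its dual, the integer column
   vectors; N_R and M_R are the corresponding real row and column vectors. *)
Definition pairing (K : pzRingType) (d : nat) (y : 'cV[K]_d)
    (x : 'rV[K]_d) : K :=
  (x *m y) 0 0.

Definition to_real (R : realType) (p q : nat) (A : 'M[int]_(p, q)) :
  'M[R]_(p, q) :=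
  map_mx intr A.
Arguments to_real R {p q} A.

Section Fans.
Variables (R : realType) (d : nat).
Implicit Types (s t : set 'rV[R]_d) (v : 'rV[int]_d).
Local Open Scope classical_set_scope.

(* The cone spanned by the rows of A. *)
Definition cone_of k (A : 'M[int]_(k, d)) : set 'rV[R]_d :=
  [set x | exists2 c : 'rV[R]_k, forall i, 0 <= c 0 i & x = c *m to_real R A].

Definition rational_cone s : Prop :=
  exists k (A : 'M[int]_(k, d)), s = cone_of A.

Definition strongly_convex s : Prop := forall x, s x -> s (- x) -> x = 0.

Definition face_of t s : Prop :=
  exists2 l : 'cV[R]_d, forall x, s x -> 0 <= pairing l x &
    t = s `&` [set x | pairing l x = 0].

Record fan := Fan {
  cones :> set 'rV[R]_d -> Prop;
  fan_finite : finite_set cones;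
  fan_rational : forall s, cones s -> rational_cone s;
  fan_strongly_convex : forall s, cones s -> strongly_convex s;
  fan_face : forall s t, cones s -> face_of t s -> cones t;
  fan_inter : forall s t, cones s -> cones t ->
    face_of (s `&` t) s /\ face_of (s `&` t) t
}.

(* The rows of B form a Z-basis of the lattice and [rowsub f B] selects
   a part of it. *)
Definition smooth_cone s : Prop :=
  exists B : 'M[int]_d, B \in unitmx /\
  exists k (f : 'I_k -> 'I_d), injective f /\ s = cone_of (rowsub f B).

Definition smooth_fan (Sigma : fan) : Prop :=
  forall s, Sigma s -> smooth_cone s.

Definition complete_fan (Sigma : fan) : Prop :=
  forall x, exists2 s, Sigma s & s x.

Definition maximal_cone (Sigma : fan) s : Prop :=
  Sigma s /\ forall t, Sigma t -> s `<=` t -> t = s.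

Definition primitive v : Prop :=
  forall (k : int) (w : 'rV[int]_d), v = k *: w -> `|k| = 1.

(* A ray is represented by its primitive generator. *)
Definition fan_rays (Sigma : fan) : set 'rV[int]_d :=
  [set v | primitive v /\ Sigma (cone_of v)].

Definition cone_rays s : set 'rV[int]_d :=
  [set v | primitive v /\ face_of (cone_of v) s].

End Fans.

(** * Tropical toric vector bundles *)

Section Bergman.
Variables (R : realType) (m : nat) (M : matroid 'I_m).

Definition bergman (w : 'rV[R]_m) : Prop :=
  forall C, circuit M C -> exists i j,
    [/\ i \in C, j \in C, i != j, w 0 i = w 0 j &
        forall k, k \in C -> w 0 i <= w 0 k].

Definition apartment (B : {set 'I_m}) (w : 'rV[R]_m) : Prop :=
  bergman w /\
  forall B', basis M B' -> \sum_(b in B') w 0 b <= \sum_(b in B) w 0 b.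

End Bergman.

(* B can serve as the basis B_s of the cone s. *)
Definition adapted_basis (R : realType) (d m : nat) (M : matroid 'I_m)
    (Phi : 'rV[R]_d -> 'rV[R]_m) (s : set 'rV[R]_d) (B : {set 'I_m}) : Prop :=
  [/\ basis M B,
      forall x, s x -> apartment M B (Phi x) &
      exists L : 'M[R]_(d, m), forall x b, s x -> b \in B ->
        Phi x 0 b = (x *m L) 0 b].

Record tropical_bundle (R : realType) (d m : nat) (Sigma : fan R d)
    (M : matroid 'I_m) := TropicalBundle {
  bundle_map :> 'rV[R]_d -> 'rV[R]_m;
  bundle_bergman : forall x, bergman M (bundle_map x);
  bundle_integral : forall v : 'rV[int]_d, exists w : 'rV[int]_m,
    bundle_map (to_real R v) = to_real R w;
  bundle_linear : forall s, Sigma s -> exists B, adapted_basis M bundle_map s B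
}.

Section Bundle.
Variables (R : realType) (d m : nat) (Sigma : fan R d) (M : matroid 'I_m).
Variable E : tropical_bundle Sigma M.
Implicit Types (e : 'I_m) (u : 'cV[int]_d) (s : set 'rV[R]_d) (r : 'rV[int]_d).

Definition coord_val e (x : 'rV[R]_d) : R := E x 0 e.

(* [us] lists, in some order, the multiset of characters of E at s. *)
Definition characters_at s (us : seq 'cV[int]_d) : Prop :=
  exists2 B, adapted_basis M E s B &
  exists2 c : 'I_m -> 'cV[int]_d,
    forall b x, b \in B -> s x -> pairing (to_real R (c b)) x = coord_val b x &
    perm_eq us [seq c b | b <- enum B].

Definition polyhedron e : set 'cV[R]_d :=
  [set y | forall v, fan_rays Sigma v ->
     pairing y (to_real R v) <= coord_val e (to_real R v)]%classic.

Definition vertex_in_direction s e (y : 'cV[R]_d) : Prop :=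
  polyhedron e y /\
  forall v, cone_rays s v -> pairing y (to_real R v) = coord_val e (to_real R v).

(* [us] lists the multiset of the vertices in the s direction of the polyhedra
   of the elements of B; in particular all these vertices exist. *)
Definition vertices_at s (B : {set 'I_m}) (us : seq 'cV[int]_d) : Prop :=
  exists2 y : 'I_m -> 'cV[R]_d,
    forall e, e \in B -> vertex_in_direction s e (y e) &
    perm_eq [seq to_real R u | u <- us] [seq y e | e <- enum B].

Definition filtration (v : 'rV[int]_d) (k : int) : {set 'I_m} :=
  [set e | k%:~R <= coord_val e (to_real R v)].

Definition global_sections u : {set 'I_m} :=
  [set e | `[< polyhedron e (to_real R u) >] ]%SET.

Definition ray_enumeration s (v : 'I_d -> 'rV[int]_d) : Prop :=
  injective v /\ range v = cone_rays s.

Section Fiber.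
Variable v : 'I_d -> 'rV[int]_d.

Definition flat_at r : {set 'I_m} :=
  (\bigcap_(i < d) filtration (v i) (r 0 i))%SET.

Definition flat_above r : {set 'I_m} :=
  span M (\bigcup_(i < d) flat_at (r + delta_mx 0 i))%SET.

Definition matroid_fiber r : matroid 'I_m :=
  quotient_matroid M (flat_at r) (flat_above r).

Definition section_elements : set ('rV[int]_d * 'I_m) :=
  [set p | exists u, [/\ p.1 = \row_i pairing u (v i),
     p.2 \in global_sections u & p.2 \notin flat_above p.1]]%classic.

End Fiber.

(* [dsum_basis (matroid_fiber v)] are the bases of the matroid fiber, the direct
   sum of the [matroid_fiber v r] over all r; up to the indexing of the summands
   nothing depends on the enumeration v of the rays of s. *)
Definition globally_generated : Prop :=
  forall s, maximal_cone Sigma s -> forall v, ray_enumeration s v ->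
  exists2 A, dsum_basis (matroid_fiber v) A &
    (A `<=` section_elements v)%classic.

End Bundle.

(* Main.v *)
From mathcomp Require Import all_boot all_order all_algebra.
Require Import Defs.

Set Implicit Arguments.
Unset Strict Implicit.
Unset Printing Implicit Defensive.

(** Fix a maximal cone [s]. The fan being smooth and complete, [s] is spanned by
    a Z-basis [v_1, ..., v_d] of N ([maximal_cone_full]), and its rays are those
    of the [v_i] ([cone_rays_full]). Give each element [e] of the matroid the
    degree [q e = (Phi(v_1)_e, ..., Phi(v_d)_e)] in [Z^d], ordered
    componentwise. The data of the statement translate into degrees:
    characters are the same as degrees, and the only possible vertex of [P_e] in
    the direction of [s] is the character of degree [q e]; the flat [F_r] is the
    up-set of all [e] with [r <= q e], and [F_{>r}] is the span of the strict
    up-set of all [e] with [r < q e]. An element [e] of [F_r] outside [F_{>r}]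
    therefore has degree exactly [r], and it is a global section of weight [r]
    precisely when the vertex of [P_e] exists. So a basis of the fiber made of
    sections is a choice, for each [r], of a basis of [F_r / F_{>r}] made of
    elements of degree [r] whose vertices exist ([section_elementsE]).

    An adapted basis [B_s] has maximal weight for all the vectors [Phi(v_i)] at
    once. Hence it contains a spanning subset of every level set of every
    [Phi(v_i)] ([max_weight_span]), and also of every [F_r], because an element
    spanned by each of two subsets of an independent set is spanned by their
    intersection ([span_setI]). It follows that exactly
    [rank (F_r / F_{>r})] elements of [B_s] have degree [r]: the characters of
    the bundle at [s] are the degrees [r], counted with these multiplicities.

    The theorem becomes a statement about matroids with a degree function. If a
    basis [A_r] of [F_r / F_{>r}] made of elements of degree [r] is chosen for
    each [r], the union [B] of the [A_r] spans, by descending induction on the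
    degree, and has as many elements of each degree as [B_s]; so it is a basis
    with the right multiset of degrees ([graded_basis_of_slices]). Conversely,
    a basis [B] with the same degrees as [B_s] has as many elements as [B_s] in
    each up-set and each strict up-set, so it spans them all, and its elements
    of degree [r] form a basis of [F_r / F_{>r}] ([slices_of_basis]). *)

Import Order.TTheory GRing.Theory Num.Theory.

(** * Spans and bases in a matroid *)

Lemma disjoint_cardU (T : finType) (A B : {set T}) :
  [disjoint A & B] -> #|A :|: B| = #|A| + #|B|.
Proof. by move=> dAB; apply/eqP; rewrite (leq_card_setU A B). Qed.

Section Span.
Variables (T : finType) (M : matroid T).
Implicit Types (A B C F I J K S U W : {set T}) (e : T).

Lemma basis_indep B : basis M B -> indep M B.
Proof. by case/maxsetP. Qed.

Lemma indep_extend I J : indep M I -> indep M J -> #|I| <= #|J| ->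
  exists K, [/\ indep M K, I \subset K, K \subset I :|: J & #|K| = #|J|].
Proof.
have [n] := ubnP (#|J| - #|I|).
elim: n I => // n IHn I ltn iI iJ leIJ.
have [eqIJ | ltIJ] := eqVneq #|I| #|J|.
  by exists I; split; rewrite // subsetUl.
have {}ltIJ : #|I| < #|J| by rewrite ltn_neqAle ltIJ.
have [e /setDP[eJ eNI] ieI] := indep_augment iI iJ ltIJ.
have ceI : #|e |: I| = #|I|.+1 by rewrite cardsU1 eNI.
have [||K [iK sIK sKJ cK]] := IHn (e |: I) _ ieI iJ.
- by rewrite ceI subnS -ltnS prednK // subn_gt0.
- by rewrite ceI.
exists K; split => //; first exact: subset_trans (subsetUr _ _) sIK.
by apply: subset_trans sKJ _; rewrite !subUset sub1set !inE eJ orbT subsetUl subsetUr.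
Qed.

Lemma leq_rank_of I A : indep M I -> I \subset A -> #|I| <= rank_of M A.
Proof.
move=> iI sIA; rewrite /rank_of.
by apply: (@leq_bigmax_cond _ _ (fun J : {set T} => #|J|)); rewrite iI.
Qed.

Lemma rank_of_witness A :
  exists I, [/\ indep M I, I \subset A & #|I| = rank_of M A].
Proof.
have [|I /andP[? ?] ?] := @eq_bigmax_cond _ [pred I : {set T} | indep M I && (I \subset A)]
  (fun I : {set T} => #|I|); last by exists I.
by apply/card_gt0P; exists set0; rewrite inE /= indep_set0 sub0set.
Qed.

Lemma rank_of_indep I : indep M I -> rank_of M I = #|I|.
Proof.
move=> iI; apply/eqP; rewrite eqn_leq leq_rank_of // andbT.
by have [J [_ /subset_leq_card ? <-]] := rank_of_witness I.
Qed.

Lemma span_ground A : span M A \subset ground M.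
Proof. by apply/subsetP => e; rewrite inE => /andP[]. Qed.

Lemma sub_span A : A \subset ground M -> A \subset span M A.
Proof.
move=> /subsetP sAg; apply/subsetP => e eA.
by rewrite inE sAg //= (setUidPr _) ?sub1set.
Qed.

Lemma in_span_indep I e : indep M I -> e \in ground M ->
  (e \in span M I) = (e \in I) || ~~ indep M (e |: I).
Proof.
move=> iI eg; rewrite inE eg /=; have [eI | eNI] /= := boolP (e \in I).
  by rewrite (setUidPr _) ?sub1set ?eqxx.
rewrite (rank_of_indep iI); have [ieI | nieI] /= := boolP (indep M (e |: I)).
  by rewrite rank_of_indep // cardsU1 eNI -[_ + _]/(#|I|.+1) gtn_eqF.
apply/eqP/anti_leq; rewrite (leq_rank_of iI (subsetUr _ _)) andbT.
have [J [iJ sJ <-]] := rank_of_witness (e |: I).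
rewrite leqNgt; apply: contra nieI => ltIJ.
suff -> : e |: I = J by [].
by apply/esym/eqP; rewrite eqEcard sJ cardsU1 eNI.
Qed.

Lemma indep_setU1 I e : indep M I -> e \in ground M -> e \notin span M I ->
  e \notin I /\ indep M (e |: I).
Proof. by move=> iI eg; rewrite in_span_indep // negb_or negbK => /andP[]. Qed.

(** If [J] were larger, an element of [J] could be added to [I]; such an element
    is not in the span of [I]. *)
Lemma leq_card_span I J : indep M I -> indep M J -> J \subset span M I ->
  #|J| <= #|I|.
Proof.
move=> iI iJ /subsetP sJ; rewrite leqNgt; apply/negP => ltIJ.
have [e /setDP[eJ eNI] ieI] := indep_augment iI iJ ltIJ.
have eg : e \in ground M by apply: (subsetP (indep_ground iJ)).
by have := sJ e eJ; rewrite in_span_indep // (negPf eNI) ieI.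
Qed.

(** A maximal independent subset [I] of [A] extends to one, [K], of [B]. If [e]
    enlarges the rank of [B], then it can be added to [K], hence also to [I]. *)
Lemma span_subset A B : A \subset B -> span M A \subset span M B.
Proof.
move=> sAB; apply/subsetP => e; rewrite !inE => /andP[-> /eqP rA] /=.
have [I [iI sIA cI]] := rank_of_witness A.
have [J [iJ sJB cJ]] := rank_of_witness B.
have [|K [iK sIK sKIJ cK]] := indep_extend iI iJ.
  by rewrite cJ; apply: leq_rank_of => //; apply: subset_trans sAB.
have sKB : K \subset B.
  by apply: subset_trans sKIJ _; rewrite subUset sJB (subset_trans sIA).
have [L [iL sL cL]] := rank_of_witness (e |: B).
apply/eqP/anti_leq; rewrite -cL -cJ (cL) (leq_rank_of iJ) ?andbT; last first.
  exact: subset_trans sJB (subsetUr _ _).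
rewrite -cL leqNgt -cK; apply/negP => ltK.
have [f /setDP[fL fNK] ifK] := indep_augment iK iL ltK.
have [ef | fNe] := eqVneq f e.
  move: ifK fNK; rewrite {f fL}ef => ieK eNK.
  have : #|e |: I| <= rank_of M (e |: A).
    by apply: leq_rank_of (setUS _ sIA); apply: indep_subset (setUS _ sIK) ieK.
  rewrite rA -cI cardsU1; case: (boolP (e \in I)) => [/(subsetP sIK)|_].
    by rewrite (negPf eNK).
  by rewrite add1n ltnn.
have : #|f |: K| <= rank_of M B.
  apply: leq_rank_of ifK _; rewrite subUset sub1set sKB andbT.
  by have := subsetP sL f fL; rewrite !inE (negPf fNe).
by rewrite -cJ cardsU1 fNK -cK ltnn.
Qed.

(** The rank of [A :|: I] is still that of [I], so an element that can be added
    to [I] would enlarge it. *)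
Lemma span_sub_span A I : indep M I -> A \subset span M I ->
  span M A \subset span M I.
Proof.
move=> iI sA; apply: subset_trans (span_subset (subsetUl A I)) _.
apply/subsetP => e; rewrite inE => /andP[eg /eqP rAI].
rewrite in_span_indep //; have [//|eNI] := boolP (e \in I); apply/negP => ieI.
have sAI : A :|: I \subset span M I.
  by rewrite subUset sA sub_span // indep_ground.
have [J [iJ sJ cJ]] := rank_of_witness (A :|: I).
have : #|e |: I| <= rank_of M (e |: (A :|: I)).
  by apply: leq_rank_of => //; apply/setUS/subsetUr.
rewrite rAI -cJ cardsU1 eNI add1n ltnNge.
by rewrite (leq_card_span iI iJ) // (subset_trans sJ).
Qed.

Lemma exists_spanning_indep A : A \subset ground M ->
  exists J, [/\ indep M J, J \subset A & A \subset span M J].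
Proof.
move=> sAg; have [J [iJ sJA cJ]] := rank_of_witness A.
exists J; split=> //; apply/subsetP => e eA; apply/negPn/negP => eN.
have [eJ ieJ] := indep_setU1 iJ (subsetP sAg e eA) eN.
have : #|e |: J| <= rank_of M A by rewrite leq_rank_of // subUset sub1set eA.
by rewrite cardsU1 eJ -cJ ltnn.
Qed.

Lemma span_closed A B : A \subset ground M -> B \subset ground M ->
  A \subset span M B -> span M A \subset span M B.
Proof.
move=> sAg sBg sAB; have [J [iJ sJB sBJ]] := exists_spanning_indep sBg.
apply: subset_trans (span_subset sJB); apply: span_sub_span => //.
exact: subset_trans (span_sub_span iJ sBJ).
Qed.

Lemma span_of_card F I J : indep M I -> indep M J -> I \subset F ->
  F \subset ground M -> F \subset span M J -> #|J| <= #|I| -> F \subset span M I.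
Proof.
move=> iI iJ sIF sFg sFJ leJI; apply/subsetP => e eF; apply/negPn/negP => eNI.
have [eI ieI] := indep_setU1 iI (subsetP sFg _ eF) eNI.
have : #|e |: I| <= #|J|.
  by apply: leq_card_span => //; apply: subset_trans sFJ; rewrite subUset sub1set eF.
by rewrite cardsU1 eI add1n ltnNge leJI.
Qed.

Lemma spanning_basis I : indep M I -> ground M \subset span M I -> basis M I.
Proof.
move=> iI sgI; apply/maxsetP; split=> // J iJ sIJ; apply/eqP.
rewrite eq_sym eqEcard sIJ leq_card_span //.
exact: subset_trans (indep_ground iJ) sgI.
Qed.

Lemma basis_spanning B : basis M B -> ground M \subset span M B.
Proof.
case/maxsetP=> iB maxB; apply/subsetP => e eg; apply/negPn/negP => eNB.
have [eB ieB] := indep_setU1 iB eg eNB.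
by move: eB; rewrite -(maxB _ ieB (subsetUr _ _)) setU11.
Qed.

Lemma indep_card_basis B I : basis M B -> indep M I -> #|I| = #|B| -> basis M I.
Proof.
move=> bB iI cI; apply: spanning_basis => //.
apply: (span_of_card iI (basis_indep bB) (indep_ground iI) _ (basis_spanning bB)) => //.
by rewrite cI.
Qed.

Lemma card_basis_rank B : basis M B -> #|B| = rank M.
Proof.
move=> bB; have iB := basis_indep bB; apply: anti_leq.
rewrite leq_rank_of ?indep_ground //=; have [J [iJ sJ]] := rank_of_witness (ground M).
rewrite -[rank M]/(rank_of M _) => <-.
by rewrite leq_card_span ?(subset_trans sJ) ?basis_spanning.
Qed.

Lemma card_basis B B' : basis M B -> basis M B' -> #|B| = #|B'|.
Proof. by move=> bB bB'; rewrite !card_basis_rank. Qed.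

(** Extend [e |: I] by elements of [U] to the size of [U]: exactly one element
    [b] of [U] is left out, and it does not lie in [I]. *)
Lemma indep_exchange I U e : indep M U -> I \proper U -> indep M (e |: I) ->
  e \notin U -> exists2 b, b \in U :\: I & indep M (e |: (U :\ b)).
Proof.
move=> iU pIU ie eU; have [sIU _] := properP pIU.
have eI : e \notin I by apply: contra eU; apply: (subsetP sIU).
have [|K [iK sK sKU cK]] := indep_extend ie iU.
  by rewrite cardsU1 eI proper_card.
have sKe : K \subset e |: U.
  by apply: subset_trans sKU _; rewrite -setUA setUS // subUset sIU subxx.
have /cards1P[b Db] : #|(e |: U) :\: K| == 1.
  by rewrite cardsD (setIidPr sKe) cK cardsU1 eU addnK.
have /setDP[beU bK] : b \in (e |: U) :\: K by rewrite Db inE.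
have eK : e \in K by apply: (subsetP sK); rewrite setU11.
have be : b != e by apply: contraNneq bK => ->.
exists b.
  rewrite inE; move: beU; rewrite !inE (negPf be) /= => ->; rewrite andbT.
  by apply: contra bK => bI; apply: (subsetP sK); rewrite inE bI orbT.
suff -> : e |: (U :\ b) = K by [].
apply/setP => f; rewrite !inE; have [->|fe] /= := eqVneq f e; first by rewrite eK.
have := in_set1 f b; rewrite -Db !inE (negPf fe) /=.
have := subsetP sKe f; rewrite !inE (negPf fe) /=.
by case: (f \in K) => [-> //| _]; case: (f == b); case: (f \in U).
Qed.

(** An element in the span of an independent set depends on a unique minimal
    subset of it. Concretely: if [e] is independent of [S1 :&: S2], it can be
    exchanged for some [b] in the union but not in the intersection; the one of
    [S1] and [S2] that avoids [b] then stays independent with [e]. *)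
Lemma span_setI I S1 S2 e : indep M I -> S1 \subset I -> S2 \subset I ->
  e \in span M S1 -> e \in span M S2 -> e \in span M (S1 :&: S2).
Proof.
move=> iI s1 s2 e1 e2.
have eg : e \in ground M by apply: (subsetP (span_ground S1)).
have i12 : indep M (S1 :&: S2) by apply: indep_subset iI; rewrite subIset ?s1.
apply/negPn/negP => /(indep_setU1 i12 eg) [eN ie].
have iU : indep M (S1 :|: S2) by apply: indep_subset iI; rewrite subUset s1.
have spanE S : S \subset I -> e \in span M S -> (e \in S) || ~~ indep M (e |: S).
  by move=> sS; rewrite in_span_indep // (indep_subset sS).
have [eU | eU] := boolP (e \in S1 :|: S2).
  have eI : e \in I by move: eU; rewrite inE => /orP[/(subsetP s1)|/(subsetP s2)].
  have eS S : S \subset I -> e \in span M S -> e \in S.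
    move=> sS /(spanE _ sS)/orP[//|/negP[]].
    by apply: indep_subset iI; rewrite subUset sub1set eI.
  by move: eN; rewrite inE (eS S1) // (eS S2).
(* after the exchange of e for b, a subset S avoiding b cannot span e *)
have nie S b : S \subset I -> S \subset S1 :|: S2 -> e \in span M S -> b \notin S ->
    ~~ indep M (e |: ((S1 :|: S2) :\ b)).
  move=> sS sSU /(spanE _ sS) eS bS; case/orP: eS => [eS | ].
    by case/negP: eU; apply: (subsetP sSU).
  apply: contra => iUb; apply: indep_subset iUb.
  by apply: setUS; rewrite subsetD1 sSU.
have sIU : S1 :&: S2 \subset S1 :|: S2 by rewrite subIset ?subsetUl.
have [|b] := indep_exchange iU _ ie eU.
  rewrite properEneq sIU andbT; apply/eqP => eq12.
  have := spanE _ s1 e1; rewrite (indep_subset _ ie) ?orbF; last first.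
    by rewrite setUS // eq12 subsetUl.
  by move=> eS1; move: eU; rewrite inE eS1.
rewrite !inE negb_and => /andP[/orP[bS|bS] _]; apply/negP.
  by apply: nie bS => //; rewrite subsetUl.
by apply: nie bS => //; rewrite subsetUr.
Qed.

(** The greedy property of bases of maximal weight: were [e] independent of the
    elements of [B] of weight at least [k], exchanging it for one of smaller
    weight would raise the total. *)
Lemma max_weight_span (R : realDomainType) (w : T -> R) B (k : R) e : basis M B ->
  (forall B', basis M B' -> (\sum_(b in B') w b <= \sum_(b in B) w b)%R) ->
  e \in ground M -> (k <= w e)%R ->
  e \in span M (B :&: [set b | (k <= w b)%R]).
Proof.
move=> bB maxB eg ke; have iB := basis_indep bB; set I := _ :&: _.
have sIB : I \subset B by apply: subsetIl.
apply/negPn/negP => eN; have [eI ie] := indep_setU1 (indep_subset sIB iB) eg eN.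
have eB : e \notin B by apply: contra eI => eB; rewrite !inE eB.
have [|b /setDP[bB' bI] ieb] := indep_exchange iB _ ie eB.
  rewrite properEneq sIB andbT; apply: contraNneq eN => ->.
  exact: (subsetP (basis_spanning bB)).
have eBb : e \notin B :\ b by rewrite inE negb_and eB orbT.
have := maxB _ (indep_card_basis bB ieb _).
rewrite big_setU1 //= (big_setD1 b bB') /= lerD2r cardsU1 eBb (cardsD1 b B) bB'.
move=> /(_ erefl); apply/negP; case: (leP k (w b)) => [kb | wbk].
  by move: bI; rewrite !inE bB' kb.
by rewrite lt_geF // (lt_le_trans wbk ke).
Qed.

(** Independence in a contraction can be tested against any basis [K] of the
    contracted set, although the definition asks for some unspecified maximal
    [J]: the two have the same size and the same span. *)
Lemma quotient_indepE F U K A : indep M K -> K \subset U -> U \subset span M K ->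
  U \subset F ->
  indep (quotient_matroid M F (span M U)) A =
    [&& A \subset F, [disjoint A & K] & indep M (A :|: K)].
Proof.
move=> iK sKU sUK sUF.
have sKs : K \subset span M U.
  apply: subset_trans (span_subset sKU); exact/sub_span/indep_ground.
have sUs : span M U \subset span M K by apply: span_sub_span.
have sKF : K \subset F by apply: subset_trans sUF.
rewrite /= /contr_indep /=; apply/andP/and3P.
- case=> sA /existsP[J /andP[/maxsetP[/andP[/andP[iJ sJF] sJs] maxJ]]].
  case/andP=> iAJ sAJ.
  move: sA; rewrite subsetD subsetI => /andP[/andP[sAg sAF] dA].
  have dAK : [disjoint A & K] by apply: disjointWr dA.
  have dAJ : [disjoint A & J] by apply: disjointWr dA.
  split=> //.
  have cKJ : #|K| = #|J|.
    apply: anti_leq; rewrite !leq_card_span ?(subset_trans sJs) //.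
    apply/subsetP => e eK; apply/negPn/negP => eN.
    have [eJ ieJ] := indep_setU1 iJ (subsetP (indep_ground iK) e eK) eN.
    move: eJ; rewrite -(maxJ (e |: J)) ?subsetUr ?setU11 //.
    by rewrite /restr_indep /= /restr_indep ieJ !subUset !sub1set sJF sJs
      (subsetP sKF) // (subsetP sKs).
  (* L extends K inside K :|: (A :|: J); as J lies in the span of K, no element
     of J is ever added, so L is A :|: K *)
  have [|L [iL sKL sL cL]] := indep_extend iK iAJ.
    by rewrite cKJ subset_leq_card ?subsetUr.
  suff sLA : L \subset A :|: K.
    suff <- : L = A :|: K by [].
    apply/eqP; rewrite eqEcard sLA cL.
    by rewrite (disjoint_cardU dAJ) (disjoint_cardU dAK) cKJ leqnn.
  apply/subsetP => e eL; have := subsetP sL e eL; rewrite !inE.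
  case/orP=> [-> | /orP[-> // | eJ]]; first by rewrite orbT.
  have := subsetP (subset_trans sJs sUs) e eJ; rewrite in_span_indep //; last first.
    exact: (subsetP (indep_ground iJ)).
  case/orP=> [-> | /negP[]]; first by rewrite orbT.
  by apply: indep_subset iL; rewrite subUset sub1set eL.
- move=> [sAF dAK iAK]; split; last first.
    apply/existsP; exists K; rewrite /restr_indep iAK subUset sAF sKF /= andbT.
    apply/maxsetP; rewrite /restr_indep /= /restr_indep iK sKF sKs; split=> //.
    move=> J /andP[/andP[iJ sJF] sJs] sKJ; apply/eqP.
    by rewrite eq_sym eqEcard sKJ leq_card_span // (subset_trans sJs).
  have sAg : A \subset ground M by apply: subset_trans (indep_ground iAK); apply: subsetUl.
  rewrite subsetD subsetI sAg sAF /=.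
  rewrite disjoint_subset; apply/subsetP => a aA; rewrite inE.
  apply/negP => /(subsetP sUs); rewrite in_span_indep ?(subsetP sAg) //.
  rewrite (disjointFr dAK aA) /= => /negP; apply; apply: indep_subset iAK.
  by rewrite setSU // sub1set.
Qed.

Lemma quotient_basisE F U K A : indep M K -> K \subset U -> U \subset span M K ->
  U \subset F -> F \subset ground M ->
  basis (quotient_matroid M F (span M U)) A <->
    [/\ A \subset F, [disjoint A & K], indep M (A :|: K) &
        F \subset span M (A :|: K)].
Proof.
move=> iK sKU sUK sUF sFg.
have indepE := quotient_indepE _ iK sKU sUK sUF; rewrite /basis.
split.
  case/maxsetP; rewrite indepE => /and3P[sAF dAK iAK] maxA; split=> //.
  apply/subsetP => e eF; apply/negPn/negP => eN.
  have [eAK ie] := indep_setU1 iAK (subsetP sFg e eF) eN.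
  move: eAK; rewrite -(maxA (e |: A)) ?subsetUr ?inE ?eqxx //.
  have eK : e \notin K.
    apply: contra eN => eK; apply: (subsetP (sub_span (indep_ground iAK))).
    by rewrite inE eK orbT.
  rewrite indepE -setUA ie andbT subUset sub1set eF sAF /=.
  by rewrite -setI_eq0 setIUl setU_eq0 !setI_eq0 disjoints1 eK.
case=> sAF dAK iAK sF; apply/maxsetP; rewrite indepE sAF dAK iAK; split=> // A'.
rewrite indepE => /and3P[sA' dA' iA'] sAA'; apply/eqP.
rewrite eq_sym eqEcard sAA' -(leq_add2r #|K|) -!disjoint_cardU // leq_card_span //.
by apply: subset_trans sF; rewrite subUset sA' (subset_trans sKU).
Qed.

End Span.

(** * Matroids with a degree function *)

Section Graded.
Variables (T : finType) (M : matroid T) (P : eqType) (le : rel P) (q : T -> P).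
Hypothesis groundM : ground M = [set: T].
Hypothesis le_refl : reflexive le.
Hypothesis le_trans : transitive le.
Hypothesis le_anti : antisymmetric le.
Implicit Types (A B C : {set T}) (p : P) (e : T).

Definition upset p : {set T} := [set e | le p (q e)].
Definition strict_upset p : {set T} := [set e | le p (q e) && (q e != p)].

(** The matroid analogue of a basis that splits the filtration by up-sets. *)
Definition graded_basis B : Prop :=
  basis M B /\ forall p, upset p \subset span M (B :&: upset p).

Definition graded_quotient p : matroid T :=
  quotient_matroid M (upset p) (span M (strict_upset p)).

Let sub_ground A : A \subset ground M.
Proof. by rewrite groundM subsetT. Qed.

Lemma upset_strict_upset p e : e \in strict_upset p ->
  upset (q e) \subset strict_upset p.
Proof.
rewrite inE => /andP[lepe nep]; apply/subsetP => f; rewrite !inE => leef.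
rewrite (le_trans lepe leef) /=; apply: contra nep => /eqP qf.
by apply/eqP/le_anti; rewrite lepe -{1}qf leef.
Qed.

Lemma strict_upset_sub p : strict_upset p \subset upset p.
Proof. by apply/subsetP => e; rewrite !inE => /andP[]. Qed.

(** A strict up-set is the union of the up-sets of its elements. *)
Lemma graded_basis_strict B p : graded_basis B ->
  strict_upset p \subset span M (B :&: strict_upset p).
Proof.
case=> _ sB; apply/subsetP => e ep; have eqe : e \in upset (q e) by rewrite inE.
apply: (subsetP (span_subset _ _) _ (subsetP (sB (q e)) e eqe)).
exact/setIS/upset_strict_upset.
Qed.

Lemma upset_split p B :
  B :&: upset p = [set e in B | q e == p] :|: (B :&: strict_upset p).
Proof.
apply/setP => e; rewrite !inE; case: (e \in B) => //=.
by have [->|] := eqVneq (q e) p; rewrite ?le_refl ?andbT.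
Qed.

Lemma slice_disjoint p B A : (forall e, e \in A -> q e = p) ->
  [disjoint A & B :&: strict_upset p].
Proof.
move=> qA; rewrite disjoint_subset; apply/subsetP => e /qA qe.
by rewrite !inE qe eqxx !andbF.
Qed.

Lemma count_enum (a : pred T) B : count a (enum B) = #|B :&: [set e | a e]|.
Proof.
rewrite -size_filter cardE; congr size; rewrite /enum_mem -filter_predI.
by apply: eq_filter => e; rewrite /= !inE andbC.
Qed.

(** A slice [A p] and the degree [p] part of [B0] both complete
    [B0 :&: strict_upset p] to a basis of [upset p], so they have the same size;
    hence the multisets of degrees agree. The union of the slices spans the
    matroid by descending induction on the degree. *)
Lemma graded_basis_of_slices B0 (A : P -> {set T}) : graded_basis B0 ->
  (forall p, basis (graded_quotient p) (A p)) -> (forall p e, e \in A p -> q e = p) ->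
  let B := [set e | e \in A (q e)] in
  basis M B /\ perm_eq [seq q e | e <- enum B] [seq q e | e <- enum B0].
Proof.
move=> gB0 bA qA B; have [bB0 sB0] := gB0; have iB0 := basis_indep bB0.
have sAp p : [/\ A p \subset upset p, [disjoint A p & B0 :&: strict_upset p],
    indep M (A p :|: (B0 :&: strict_upset p)) &
    upset p \subset span M (A p :|: (B0 :&: strict_upset p))].
  have iK : indep M (B0 :&: strict_upset p) by rewrite (indep_subset _ iB0) ?subsetIl.
  apply/(quotient_basisE _ iK (subsetIr _ _) (graded_basis_strict p gB0)
    (strict_upset_sub p) (sub_ground _)); exact: bA.
have sliceE p : [set e in B | q e == p] = A p.
  apply/setP => e; rewrite !inE; have [->|qe] := eqVneq; first by rewrite andbT.
  by rewrite andbF; apply/esym/negP => /qA/eqP; apply/negP.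
have cA p : #|A p| = #|[set e in B0 | q e == p]|.
  have [sAF dA iA sF] := sAp p.
  have iB0p : indep M (B0 :&: upset p) by apply: indep_subset iB0; apply: subsetIl.
  apply/eqP; rewrite -(eqn_add2r #|B0 :&: strict_upset p|) -disjoint_cardU //.
  rewrite -disjoint_cardU; last by apply: slice_disjoint => e; rewrite inE => /andP[_ /eqP].
  rewrite -upset_split; apply/eqP/anti_leq/andP; split.
    apply: (leq_card_span iB0p iA); apply: subset_trans (sB0 p).
    by rewrite subUset sAF (subset_trans (subsetIr _ _)) ?strict_upset_sub.
  by apply: (leq_card_span iA iB0p); apply: subset_trans sF; apply: subsetIr.
have peq : perm_eq [seq q e | e <- enum B] [seq q e | e <- enum B0].
  have cE C p : count (pred1 p) [seq q e | e <- enum C] = #|[set e in C | q e == p]|.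
    by rewrite count_map count_enum; congr #|pred_of_set _|; apply/setP => e; rewrite !inE.
  by apply/allP => p _ /=; rewrite !cE sliceE cA.
split=> //.
have cB : #|B| = #|B0| by rewrite !cardE -(size_map q) (perm_size peq) size_map.
have sTB e : e \in span M B.
  (* the up-sets shrink strictly as the degree grows *)
  have [n] := ubnP #|upset (q e)|; elim: n e => // n IHn e le_n.
  have [_ _ _ sF] := sAp (q e).
  have /(subsetP sF) : e \in upset (q e) by rewrite inE.
  apply/subsetP/span_closed => //; rewrite subUset; apply/andP; split.
    apply: subset_trans (sub_span (sub_ground B)); apply/subsetP => f fA.
    by rewrite inE (qA _ _ fA).
  apply/subsetP => f /setIP[_ fe]; apply: IHn; apply: leq_trans _ (le_n : _ <= n).
  apply: proper_card; apply/properP; split.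
    exact: subset_trans (upset_strict_upset fe) (strict_upset_sub _).
  exists e; first by rewrite inE.
  by apply/negP => /(subsetP (upset_strict_upset fe)); rewrite inE eqxx andbF.
(* B spans and has the size of a basis, so it is independent *)
have [J [iJ sJB sBJ]] := exists_spanning_indep (sub_ground B).
have bJ : basis M J.
  apply: spanning_basis => //; apply/subsetP => e _.
  exact: (subsetP (span_closed (sub_ground B) (sub_ground J) sBJ)).
suff <- : J = B by [].
by apply/eqP; rewrite eqEcard sJB cB (card_basis bB0 bJ) leqnn.
Qed.

(** Having the same degrees as [B0], the basis [B] meets every up-set and strict
    up-set in as many elements as [B0] does, which is the rank. So it spans all
    of them, and in degree [p] it completes a basis of [strict_upset p] to one
    of [upset p]. *)
Lemma slices_of_basis B0 B p : graded_basis B0 -> basis M B ->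
  perm_eq [seq q e | e <- enum B] [seq q e | e <- enum B0] ->
  basis (graded_quotient p) [set e in B | q e == p].
Proof.
move=> gB0 bB peq; have [bB0 sB0] := gB0.
have iB := basis_indep bB; have iB0 := basis_indep bB0.
have iI I C : indep M I -> indep M (I :&: C) by apply/indep_subset/subsetIl.
have cE a C : count a [seq q e | e <- enum C] = #|C :&: [set e | a (q e)]|.
  by rewrite count_map count_enum.
have sp (a : pred P) : [set e | a (q e)] \subset span M (B0 :&: [set e | a (q e)]) ->
    [set e | a (q e)] \subset span M (B :&: [set e | a (q e)]).
  move=> sa; apply: (span_of_card _ _ _ _ sa); rewrite ?iI ?subsetIr //.
  by rewrite -!cE (permP peq).
have sF : upset p \subset span M (B :&: upset p) by apply/sp/sB0.
have sU : strict_upset p \subset span M (B :&: strict_upset p).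
  apply: (sp (fun p' => le p p' && (p' != p))); exact: graded_basis_strict.
apply/(quotient_basisE _ (iI _ _ iB) (subsetIr _ _) sU (strict_upset_sub p)
  (sub_ground _)).
rewrite -upset_split; split; rewrite ?iI //.
  by apply/subsetP => e; rewrite !inE => /andP[_ /eqP->].
by apply: slice_disjoint => e; rewrite inE => /andP[_ /eqP].
Qed.

End Graded.

(** * Maximal cones of a smooth complete fan *)

From mathcomp Require Import fingroup perm.
From mathcomp Require Import boolp classical_sets cardinality reals.

Local Open Scope ring_scope.

Section Cones.
Variables (R : realType) (d : nat).
Implicit Types (s t : set 'rV[R]_d) (V B : 'M[int]_d) (x y : 'rV[R]_d).

Lemma to_real_unit B : B \in unitmx -> to_real R B \in unitmx.
Proof.
by rewrite !unitmxE /to_real det_map_mx; apply: rmorph_unit.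
Qed.

(** The coordinates of [x] in the basis formed by the rows of [B]. *)
Definition coords B x := x *m invmx (to_real R B).

Lemma cone_of_rowsubP B k (f : 'I_k -> 'I_d) x : B \in unitmx -> injective f ->
  cone_of (rowsub f B) x <->
  (forall j, 0 <= coords B x 0 j) /\
  (forall j, j \notin codom f -> coords B x 0 j = 0).
Proof.
move=> uB injf; have urB := to_real_unit uB.
have rsE : to_real R (rowsub f B) = rowsub f 1%:M *m to_real R B.
  by rewrite mul_rowsub_mx mul1mx; apply/matrixP => i j; rewrite !mxE.
have cE (c : 'rV[R]_k) : coords B (c *m to_real R (rowsub f B)) = c *m rowsub f 1%:M.
  by rewrite /coords rsE mulmxA mulmxK.
have cEf (c : 'rV[R]_k) i : (c *m rowsub f 1%:M) 0 (f i) = c 0 i.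
  rewrite mxE (bigD1 i) //= !mxE eqxx mulr1 big1 ?addr0 // => j ji.
  by rewrite !mxE (inj_eq injf) (negPf ji) mulr0.
have cEn (c : 'rV[R]_k) j : j \notin codom f -> (c *m rowsub f 1%:M) 0 j = 0.
  move=> jf; rewrite mxE big1 // => i _; rewrite !mxE.
  by case: eqP => [fij|_]; rewrite ?mulr0 //; case/negP: jf; rewrite -fij codom_f.
split.
  case=> c c0 ->; rewrite cE; split=> j; last exact: cEn.
  have [/codomP[i ->]|jf] := boolP (j \in codom f); first by rewrite cEf.
  by rewrite cEn.
case=> x0 xn; exists (\row_i coords B x 0 (f i)); first by move=> i; rewrite mxE.
apply: (can_inj (mulmxK (_ : invmx (to_real R B) \in unitmx))).
  by rewrite unitmx_inv.
rewrite -/(coords B x) -/(coords B _) cE; apply/rowP => j.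
have [/codomP[i ->]|jf] := boolP (j \in codom f); first by rewrite cEf [RHS]mxE.
by rewrite cEn // xn.
Qed.

(** Smooth cones are closed; only rays issuing from a point outside are
    considered. One coordinate of [x] has a sign that is forbidden on [t], and
    it keeps this sign for [h] small. *)
Lemma smooth_cone_closed t x w : smooth_cone t -> ~ t x ->
  exists2 e : R, 0 < e & forall h, 0 < h -> h < e -> ~ t (x + h *: w).
Proof.
move=> [B [uB [k [f [injf ->]]]]] /(cone_of_rowsubP x uB injf) nx.
set a := coords B x; set b := coords B w.
have cD h j : coords B (x + h *: w) 0 j = a 0 j + h * b 0 j.
  by rewrite /coords mulmxDl -scalemxAl !mxE.
have [j aj nj] : exists2 j, a 0 j != 0 & forall z, cone_of (rowsub f B) z ->
    (a 0 j < 0 -> 0 <= coords B z 0 j) /\ (0 < a 0 j -> coords B z 0 j <= 0).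
  apply: contrapT => H; apply: nx; split => j.
    rewrite leNgt; apply/negP => aj; apply: H; exists j; first by rewrite lt_eqF.
    move=> z /(cone_of_rowsubP z uB injf)[z0 _]; split=> // aj'.
    by have := lt_trans aj aj'; rewrite ltxx.
  move=> jf; apply/eqP/negPn/negP => aj; apply: H; exists j => //.
  by move=> z /(cone_of_rowsubP z uB injf)[_ /(_ j jf)->].
(* the denominator is nonzero even when the j-th coordinate of w vanishes *)
exists (`|a 0 j| / (`|b 0 j| + 1)).
  by rewrite divr_gt0 ?normr_gt0 // ltr_wpDl.
move=> h h0; rewrite ltr_pdivlMr ?ltr_wpDl // => hlt /nj; rewrite cD => -[n1 n2].
have hb : `|h * b 0 j| < `|a 0 j|.
  rewrite normrM (gtr0_norm h0); apply: le_lt_trans hlt.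
  by rewrite ler_pM2l // lerDl.
move: hb; rewrite ltr_norml; case: (ltgtP (a 0 j) 0) aj n1 n2 => // aj _ n1 n2.
  rewrite (ltr0_norm aj) => /andP[_ hb]; have := n1 isT.
  by rewrite leNgt -ltrBrDl sub0r hb.
rewrite (gtr0_norm aj) => /andP[hb _]; have := n2 isT.
by rewrite leNgt -ltrBlDl sub0r hb.
Qed.

Lemma finite_common_radius (A : set (set 'rV[R]_d)) (Q : set 'rV[R]_d -> R -> Prop) :
  finite_set A ->
  (forall t, A t -> exists2 e : R, 0 < e & forall h, 0 < h -> h < e -> Q t h) ->
  exists2 e : R, 0 < e & forall h, 0 < h -> h < e -> forall t, A t -> Q t h.
Proof.
move=> /finite_seqP[l ->]; elim: l => [|t l IHl] H.
  by exists 1 => // h _ _ t; rewrite /= in_nil.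
have [e1 e10 H1] := H t (mem_head _ _).
have [|e2 e20 H2] := IHl.
  by move=> t' tl; apply: H; rewrite /= inE [_ \in _]tl orbT.
exists (Num.min e1 e2); first by rewrite lt_min e10.
move=> h h0; rewrite lt_min => /andP[he1 he2] t'; rewrite /= inE => /orP[/eqP->|].
  exact: H1.
exact: H2.
Qed.

Lemma cone_of_row k (A : 'M[int]_(k, d)) i : cone_of A (to_real R (row i A)).
Proof.
exists (delta_mx 0 i); first by move=> j; rewrite mxE ler0n.
by rewrite -rowE; apply/rowP => j; rewrite !mxE.
Qed.

Lemma pairing_sum k (c : 'rV[R]_k) (A : 'M[R]_(k, d)) (l : 'cV[R]_d) :
  pairing l (c *m A) = \sum_i c 0 i * pairing l (row i A).
Proof.
rewrite /pairing -mulmxA mxE; apply: eq_bigr => i _; congr (_ * _).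
by rewrite !mxE; apply: eq_bigr => j _; rewrite !mxE.
Qed.

Lemma to_real_row k (A : 'M[int]_(k, d)) i : to_real R (row i A) = row i (to_real R A).
Proof. by apply/rowP => j; rewrite !mxE. Qed.

(** Suppose that [s] is spanned by a proper part of a lattice basis, and move a
    little from the sum [x0] of its generators in the direction [w] of a missing
    basis vector. The point reached lies in some cone [t]; as there are finitely
    many cones, all closed, a small move only reaches cones that contain [x0].
    The face [s `&` t] of [s] contains the interior point [x0], so it is [s],
    and [t = s] by maximality. But the point reached is not in [s]. *)
Lemma maximal_cone_full (Sigma : fan R d) s : smooth_fan Sigma ->
  complete_fan Sigma -> maximal_cone Sigma s ->
  exists2 V, V \in unitmx & s = cone_of V.
Proof.
move=> smooth complete [Ss maxs].
have [B [uB [k [f [injf defs]]]]] := smooth s Ss.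
have urB := to_real_unit uB.
have [fonto | nonto] := pselect (forall j, j \in codom f).
  have kd : k = d.
    apply/anti_leq/andP; split.
      by have := leq_card f injf; rewrite !card_ord.
    rewrite -[leqLHS](card_ord d) -[leqRHS](card_ord k) -(card_codom injf).
    by apply/subset_leq_card/fintype.subsetP => j _.
  subst k; exists (rowsub f B) => //.
  pose g := perm.perm injf.
  have -> : rowsub f B = row_perm g B.
    by apply/matrixP => i j; rewrite !mxE perm.permE.
  by rewrite row_permE unitmx_mul unitmx_perm.
have [j jf] : exists j, j \notin codom f.
  by apply: contrapT => H; apply: nonto => j; apply/negPn/negP => jf; apply: H; exists j.
pose x0 : 'rV[R]_d := const_mx 1 *m to_real R (rowsub f B).
pose w : 'rV[R]_d := delta_mx 0 j *m to_real R B.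
have [||e e0 He] := @finite_common_radius (cones Sigma) (fun t h => ~ t x0 -> ~ t (x0 + h *: w)).
- exact: fan_finite.
- move=> t St; have [tx0 | ntx0] := pselect (t x0); first by exists 1.
  have [e e0 He] := smooth_cone_closed w (smooth t St) ntx0.
  by exists e => // h h0 he _; apply: He.
have he0 : 0 < e / 2 by rewrite divr_gt0.
have hee : e / 2 < e by rewrite ltr_pdivrMr // ltr_pMr // ltr1n.
have [t St tw] := complete (x0 + (e / 2) *: w).
have tx0 : t x0 by apply: contrapT => ntx0; apply: (He _ he0 hee t St ntx0).
have sx0 : s x0 by rewrite defs; exists (const_mx 1) => // i; rewrite mxE.
have [[l l0 defl] _] := fan_inter Ss St.
have lx0 : pairing l x0 = 0.
  by have : (s `&` t)%classic x0 by []; rewrite defl => -[].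
have st : (s `<=` t)%classic.
  move=> x sx; suff : (s `&` t)%classic x by case.
  rewrite defl; split=> //=; move: sx; rewrite defs => -[c c0 ->].
  rewrite pairing_sum big1 // => i _.
  suff -> : pairing l (row i (to_real R (rowsub f B))) = 0 by rewrite mulr0.
  move: lx0; rewrite pairing_sum => /eqP; rewrite psumr_eq0; last first.
    by move=> i' _; rewrite mxE mul1r -to_real_row l0 // defs; apply: cone_of_row.
  by move=> /allP/(_ i (mem_index_enum _)); rewrite mxE mul1r => /eqP.
move: tw; rewrite (maxs t St st) defs => /(cone_of_rowsubP _ uB injf)[_ /(_ j jf)].
have /(cone_of_rowsubP _ uB injf)[_ /(_ j jf)] : cone_of (rowsub f B) x0 by rewrite -defs.
rewrite /coords mulmxDl -scalemxAl mulmxK // !mxE => -> /eqP.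
by rewrite !eqxx add0r mulr1 gt_eqF.
Qed.

(** If the ray of [v] is the face of [cone_of V] where [l] vanishes, then [l]
    also vanishes on every [row i V] occurring in [v], so [row i V] is a
    multiple of [v], and [v] is an integer multiple of [row i V]. Conversely the
    ray of [row i V] is the face where the sum of the other coordinates
    vanishes. *)
Lemma cone_rays_full V : V \in unitmx ->
  cone_rays (cone_of V : set 'rV[R]_d) = range (fun i => row i V).
Proof.
move=> uV; have urV := to_real_unit uV.
rewrite eqEsubset; split => v.
  case=> pv [l l0 defl].
  have vv : cone_of v (to_real R v : 'rV[R]_d).
    exists 1%:M; last by rewrite mul1mx.
    by move=> i; rewrite mxE ler0n.
  have v0 : v != 0.
    apply/eqP => v0; have := pv 2%:Z 0; rewrite v0 scaler0 => /(_ erefl).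
    by [].
  have [a va] : exists a, v = a *m V by exists (v *m invmx V); rewrite mulmxKV.
  have := vv; rewrite defl => -[[c c0 vc] lv].
  have cE : c = to_real R a.
    apply: (can_inj (mulmxK urV)); rewrite -vc {1}va.
    exact: map_mxM.
  have a0 i : 0 <= a 0 i by have := c0 i; rewrite cE mxE ler0z.
  have [i ai] : exists i, a 0 i != 0.
    apply: contrapT => H; case/negP: v0; rewrite va; apply/eqP.
    suff -> : a = 0 by rewrite mul0mx.
    by apply/rowP => i; rewrite [RHS]mxE; apply/eqP/negPn/negP => ai; apply: H; exists i.
  have li : pairing l (to_real R (row i V)) = 0.
    move: lv => /=; rewrite vc pairing_sum => /eqP; rewrite psumr_eq0; last first.
      by move=> i' _; rewrite mulr_ge0 // -to_real_row l0 //; apply: cone_of_row.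
    move=> /allP/(_ i (mem_index_enum _)); rewrite mulf_eq0 cE mxE intr_eq0 (negPf ai) /=.
    by rewrite to_real_row => /eqP.
  have : cone_of v (to_real R (row i V)) by rewrite defl; split=> //; apply: cone_of_row.
  case=> b b0 Vb.
  have ei : delta_mx 0 i = b *m to_real R a.
    apply: (can_inj (mulmxK urV)); rewrite -rowE -to_real_row Vb {1}va -mulmxA; congr (_ *m _).
    exact: map_mxM.
  have bE j : (b *m to_real R a) 0 j = b 0 0 * (a 0 j)%:~R.
    by rewrite mxE big_ord1 mxE.
  have b0' : b 0 0 != 0.
    apply/eqP => b00; have /rowP/(_ i) := ei.
    by rewrite bE b00 mul0r mxE !eqxx => /eqP; rewrite oner_eq0.
  have aE : v = a 0 i *: row i V.
    rewrite rowE scalemxAl {1}va; congr (_ *m _); apply/rowP => j; rewrite !mxE eqxx /=.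
    have [->|ji] := eqVneq; first by rewrite mulr1.
    have /rowP/(_ j) := ei; rewrite bE mxE (negPf ji) andbF => /esym/eqP.
    by rewrite mulf_eq0 (negPf b0') intr_eq0 /= mulr0 => /eqP.
  exists i => //=; rewrite aE; have := pv _ _ aE; rewrite ger0_norm // => ->.
  by rewrite scale1r.
case=> i _ <- {v}; split.
  move=> k w rowV.
  have k1 : k * (w *m invmx V) 0 i = 1.
    have <- : (row i V *m invmx V) 0 i = 1 by rewrite rowE mulmxK // mxE !eqxx.
    by rewrite rowV -scalemxAl [RHS]mxE.
  have /eqP := congr1 absz k1; rewrite abszM muln_eq1 => /andP[/eqP ck _].
  by rewrite -abszE ck.
(* l is the sum of the coordinates other than the i-th *)
pose l : 'cV[R]_d := invmx (to_real R V) *m (\col_j (j != i)%:R).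
have lE c : pairing l (c *m to_real R V) = \sum_(j | j != i) c 0 j.
  rewrite /pairing /l mulmxA mulmxK // mxE [RHS]big_mkcond; apply: eq_bigr => j _.
  by rewrite mxE; case: (j != i); rewrite ?mulr1 ?mulr0.
exists l.
  by move=> x [c c0 ->]; rewrite lE sumr_ge0.
rewrite eqEsubset; split=> x.
  move=> [c c0 ->]; rewrite to_real_row rowE mulmxA; split.
    exists (c *m delta_mx 0 i) => // j; rewrite mxE big_ord1 mxE mulr_ge0 ?ler0n //.
  rewrite /= lE big1 // => j ji.
  by rewrite mxE big_ord1 mxE (negPf ji) andbF mulr0.
move=> [[c c0 ->]]; rewrite /= lE => /eqP; rewrite psumr_eq0 // => /allP cj.
exists (const_mx (c 0 i)); first by move=> j; rewrite mxE.
rewrite to_real_row rowE mulmxA; congr (_ *m _); apply/rowP => j.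
rewrite mxE big_ord1 !mxE eqxx /=; have [->|ji] := eqVneq j i; first by rewrite mulr1.
by rewrite mulr0; apply/eqP; move: (cj j (mem_index_enum _)); rewrite ji.
Qed.

End Cones.

(** * Bases of the fiber and degrees *)

Lemma dsum_basisE (K : Type) (T : finType) (N : K -> matroid T) (A : set (K * T)) :
  dsum_basis N A <-> forall i, basis (N i) [set e | `[< A (i, e) >]]%SET.
Proof.
split=> [[iA maxA] i | bA].
  apply/maxsetP; split=> // I iI sI.
  pose A' : set (K * T) := [set p | A p \/ p.1 = i /\ p.2 \in I]%classic.
  have sAA' : (A `<=` A')%classic by move=> p Ap; left.
  have A'E : A' = A.
    apply: maxA => // j; have [->|nji] := pselect (j = i).
      suff -> : [set e | `[< A' (i, e) >]]%SET = I by [].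
      apply/finset.setP => e; rewrite inE; apply/asboolP/idP => [[Ae|[]//]|eI]; last by right.
      by apply: (fintype.subsetP sI); rewrite inE; apply/asboolP.
    suff -> : [set e | `[< A' (j, e) >]]%SET = [set e | `[< A (j, e) >]]%SET by [].
    apply/finset.setP => e; rewrite !inE; apply/asboolP/asboolP => [[//|[ji]]|]; last by left.
    by case: nji.
  apply/eqP; rewrite finset.eqEsubset sI andbT; apply/fintype.subsetP => e eI.
  by rewrite inE; apply/asboolP; rewrite -A'E; right.
split=> [i|A' iA' sAA']; first exact: basis_indep (bA i).
rewrite eqEsubset; split=> // -[i e] A'e; have /maxsetP[_ maxA] := bA i.
have sub : ([set f | `[< A (i, f) >]] \subset [set f | `[< A' (i, f) >]])%SET.
  by apply/fintype.subsetP => f; rewrite !finset.in_set => /asboolP Af; apply/asboolP/sAA'.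
have : e \in [set f | `[< A' (i, f) >]]%SET by rewrite inE; apply/asboolP.
by rewrite (maxA _ (iA' i) sub) inE => /asboolP.
Qed.

Definition le_row d (p p' : 'rV[int]_d) : bool := [forall i, p 0 i <= p' 0 i].

Lemma le_row_refl d : reflexive (@le_row d).
Proof. by move=> p; apply/forallP. Qed.

Lemma le_row_trans d : transitive (@le_row d).
Proof.
move=> p2 p1 p3 /forallP le12 /forallP le23; apply/forallP => i.
exact: le_trans (le12 i) (le23 i).
Qed.

Lemma le_row_anti d : antisymmetric (@le_row d).
Proof.
move=> p p' /andP[/forallP lepp' /forallP lep'p]; apply/rowP => i.
by apply/le_anti; rewrite lepp' lep'p.
Qed.

(** The strict order is generated by the unit steps, which are the ones used to
    define [F_{>r}]. *)
Lemma lt_rowP d (p p' : 'rV[int]_d) :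
  reflect (exists i, le_row (p + delta_mx 0 i) p') (le_row p p' && (p' != p)).
Proof.
apply: (iffP andP) => [[lepp' nepp'] | [i lei]].
  have [i nei] : exists i, p' 0 i != p 0 i.
    apply: contrapT => H; case/eqP: nepp'; apply/rowP => i; apply/eqP/negPn/negP => nei.
    by apply: H; exists i.
  exists i; apply/forallP => j; rewrite !mxE eqxx /=.
  have := forallP lepp' j; case: (eqVneq j i) => [->|_]; last by rewrite addr0.
  by rewrite le_eqVlt eq_sym (negPf nei) /= -lezD1.
split.
  apply: le_row_trans lei; apply/forallP => j; rewrite !mxE lerDl.
  exact: ler0n.
apply: contraTneq lei => ->; apply/forallPn; exists i.
by rewrite !mxE !eqxx -ltNge ltrDl.
Qed.

(** * Characters as degrees *)

Section Characters.
Variables (R : realType) (d : nat) (V : 'M[int]_d).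
Hypothesis unitV : V \in unitmx.

Lemma pairing_to_real (u : 'cV[int]_d) (x : 'rV[int]_d) :
  pairing (to_real R u) (to_real R x) = (pairing u x)%:~R.
Proof. by rewrite /pairing /to_real -map_mxM mxE. Qed.

Lemma to_real_inj p q : injective (@to_real R p q).
Proof.
by move=> A B AB; apply/matrixP => i j; have /matrixP/(_ i j) := AB; rewrite !mxE => /intr_inj.
Qed.

Lemma row_inj : injective (fun i => row i V).
Proof.
move=> i j /= ij; have /(congr1 (mulmx^~ (invmx V))) := ij.
rewrite !rowE !mulmxK // => /rowP/(_ i); rewrite !mxE !eqxx /=.
by case: eqVneq.
Qed.

(** The character whose values on the rows of [V] are the entries of [p]. *)
Definition dual_vec (p : 'rV[int]_d) : 'cV[int]_d := invmx V *m p^T.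

Lemma pairing_row k (u : 'cV[int]_d) (A : 'M[int]_(k, d)) i :
  pairing u (row i A) = (A *m u) i 0.
Proof. by rewrite /pairing -row_mul mxE. Qed.

Lemma pairing_dual_vec (p : 'rV[int]_d) i : pairing (dual_vec p) (row i V) = p 0 i.
Proof. by rewrite pairing_row /dual_vec mulKVmx // mxE. Qed.

Lemma dual_vec_inj : injective dual_vec.
Proof.
by move=> p p' E; apply/rowP => i; rewrite -!pairing_dual_vec E.
Qed.

Lemma dual_vec_unique (y : 'cV[R]_d) (p : 'rV[int]_d) :
  (forall i, pairing y (to_real R (row i V)) = (p 0 i)%:~R) ->
  y = to_real R (dual_vec p).
Proof.
move=> yp; apply: (can_inj (mulKmx (to_real_unit R unitV))).
apply/colP => i; have := yp i; rewrite -(pairing_dual_vec p i) -pairing_to_real.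
by rewrite /pairing to_real_row -!row_mul !mxE.
Qed.

Lemma dual_vec_pairing (u : 'cV[int]_d) : dual_vec (\row_i pairing u (row i V)) = u.
Proof.
apply: (@to_real_inj _ _); apply/esym/dual_vec_unique => i.
by rewrite pairing_to_real mxE.
Qed.

Lemma cone_of_row_perm (g : 'S_d) :
  cone_of (row_perm g V) = cone_of V :> set 'rV[R]_d.
Proof.
have E : to_real R (row_perm g V) = perm_mx g *m to_real R V.
  by rewrite row_permE /to_real map_mxM map_perm_mx.
rewrite eqEsubset; split=> x [c c0 ->].
  exists (c *m perm_mx g); last by rewrite -mulmxA -E.
  by move=> j; rewrite -[g]invgK -col_permE mxE.
exists (c *m perm_mx g^-1); first by move=> j; rewrite -col_permE mxE.
by rewrite E -mulmxA (mulmxA _ (perm_mx g)) -perm_mxM mulVg perm_mx1 mul1mx.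
Qed.

End Characters.

(** An enumeration of the rays of a maximal cone is, up to reordering, the list
    of rows of a unimodular matrix, hence itself such a list. *)
Lemma ray_enumeration_full (R : realType) d (Sigma : fan R d) s v :
  smooth_fan Sigma -> complete_fan Sigma -> maximal_cone Sigma s ->
  ray_enumeration s v ->
  exists V, [/\ V \in unitmx, s = cone_of V & v = (fun i => row i V)].
Proof.
move=> smooth complete maxs [injv rv].
have [V uV sV] := maximal_cone_full smooth complete maxs.
have vE i : exists j, v i = row j V.
  have : range v (v i) by exists i.
  by rewrite rv sV cone_rays_full // => -[j _ <-]; exists j.
have [g gE] := choice vE.
have injg : injective g by move=> i j gij; apply: injv; rewrite !gE gij.
exists (row_perm (perm injg) V); split.
- by rewrite row_permE unitmx_mul unitmx_perm.
- by rewrite cone_of_row_perm.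
- by apply: funext => i; rewrite gE; apply/rowP => j; rewrite !mxE permE.
Qed.

(** * The bundle at a maximal cone *)

Section BundleAtCone.
Variables (R : realType) (d m : nat) (Sigma : fan R d) (M : matroid 'I_m).
Variables (E : tropical_bundle Sigma M) (V : 'M[int]_d).
Hypothesis groundM : ground M = [set: 'I_m]%SET.
Hypothesis unitV : V \in unitmx.
Hypothesis Sigma_V : Sigma (cone_of V).

Definition lattice_map (x : 'rV[int]_d) : 'rV[int]_m :=
  sval (cid (bundle_integral E x)).

Lemma lattice_mapE x e : coord_val E e (to_real R x) = (lattice_map x 0 e)%:~R.
Proof.
by rewrite /coord_val /lattice_map; case: cid => w /= ->; rewrite mxE.
Qed.

Definition degree (e : 'I_m) : 'rV[int]_d := \row_i lattice_map (row i V) 0 e.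

Lemma degreeE e i : coord_val E e (to_real R (row i V)) = (degree e 0 i)%:~R.
Proof. by rewrite lattice_mapE mxE. Qed.

Let v i := row i V.

Lemma flat_atE p : flat_at E v p = upset (@le_row d) degree p.
Proof.
apply/finset.setP => e; rewrite inE; apply/bigcapP/forallP => [H i | H i _].
  by have := H i isT; rewrite inE degreeE ler_int.
by rewrite inE degreeE ler_int H.
Qed.

Lemma flat_aboveE p :
  flat_above E v p = span M (strict_upset (@le_row d) degree p).
Proof.
congr (span M _); apply/finset.setP => e; rewrite inE; apply/bigcupP/lt_rowP.
  by case=> i _; rewrite flat_atE inE => lei; exists i.
by case=> i lei; exists i => //; rewrite flat_atE inE.
Qed.

(** An up-set is an intersection of level sets of the maps [Phi(v_i)], and [B]
    has maximal weight for each of them. *)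
Lemma adapted_graded B : adapted_basis M E (cone_of V) B ->
  graded_basis M (@le_row d) degree B.
Proof.
case=> bB apB _; split=> // p; apply/fintype.subsetP => e ep.
have -> : upset (@le_row d) degree p =
    (\bigcap_(i < d) [set b | ((p 0 i)%:~R : R) <= coord_val E b (to_real R (row i V))])%SET.
  apply/finset.setP => f; rewrite inE; apply/forallP/bigcapP => [H i _ | H i].
    by rewrite inE degreeE ler_int.
  by have := H i isT; rewrite inE degreeE ler_int.
pose Q (W : {set 'I_m}) := e \in span M (B :&: W).
apply: (big_ind Q); rewrite /Q.
- rewrite finset.setIT; apply: (fintype.subsetP (basis_spanning bB)).
  by rewrite groundM inE.
- move=> W1 W2 e1 e2; rewrite finset.setIIr.
  exact: (span_setI (basis_indep bB) (finset.subsetIl _ _) (finset.subsetIl _ _) e1 e2).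
- move=> i _; have [|_ maxB] := apB (to_real R (row i V)); first exact: cone_of_row.
  apply: (max_weight_span bB maxB); first by rewrite groundM inE.
  by rewrite -/(coord_val E e _) degreeE ler_int; move: ep; rewrite inE => /forallP.
Qed.

Definition degree_char e := dual_vec V (degree e).

(** On [B] the map is linear over the cone, so its coordinates are characters,
    and a character is determined by its values on the generators. *)
Lemma characters_atE us : characters_at E (cone_of V) us <->
  exists2 B, adapted_basis M E (cone_of V) B &
    perm_eq us [seq degree_char b | b <- enum B].
Proof.
split=> [[B aB [c cE uE]] | [B aB uE]]; exists B => //.
  suff <- : [seq c b | b <- enum B] = [seq degree_char b | b <- enum B] by [].
  apply/eq_in_map => b; rewrite mem_enum => bB.
  apply: (@to_real_inj R); apply: dual_vec_unique => // i.
  by rewrite cE //; [rewrite degreeE | apply: cone_of_row].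
exists degree_char => // b x bB sx; have [_ _ [L LE]] := aB.
rewrite /coord_val (LE x b sx bB); have [c c0 ->] := sx.
have LbE z : (z *m L) 0 b = pairing (col b L) z.
  by rewrite /pairing !mxE; apply: eq_bigr => j _; congr (_ * _); rewrite mxE.
rewrite LbE.
rewrite !pairing_sum; apply: eq_bigr => i _; congr (_ * _).
rewrite -to_real_row pairing_to_real pairing_dual_vec // -degreeE /coord_val.
rewrite (LE _ b _ bB); last exact: cone_of_row.
by rewrite LbE.
Qed.

Lemma vertex_in_directionE e y : vertex_in_direction E (cone_of V) e y <->
  y = to_real R (degree_char e) /\ polyhedron E e y.
Proof.
rewrite /vertex_in_direction cone_rays_full //; split=> -[].
  move=> Py yV; split=> //; apply: dual_vec_unique => // i.
  by rewrite yV ?degreeE //; exists i.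
move=> -> Py; split=> // _ [i _ <-].
by rewrite pairing_to_real pairing_dual_vec // degreeE.
Qed.

Lemma vertices_atE B us : vertices_at E (cone_of V) B us <->
  (forall e, e \in B -> polyhedron E e (to_real R (degree_char e))) /\
  perm_eq us [seq degree_char e | e <- enum B].
Proof.
split=> [[y yE uE] | [PB uE]].
  have {}yE e : e \in B -> y e = to_real R (degree_char e) /\ polyhedron E e (y e).
    by move=> /yE/vertex_in_directionE.
  split=> [e /yE[<-]//|]; apply: (perm_map_inj (@to_real_inj R _ _)).
  rewrite -map_comp; suff <- : [seq y e | e <- enum B] =
      [seq to_real R (degree_char e) | e <- enum B] by [].
  by apply/eq_in_map => e; rewrite mem_enum => /yE[].
exists (fun e => to_real R (degree_char e)).
  by move=> e /PB Pe; apply/vertex_in_directionE.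
by rewrite (map_comp (to_real R) degree_char); apply: perm_map.
Qed.

Lemma fan_rays_row i : fan_rays Sigma (row i V).
Proof.
have : cone_rays (cone_of V : set 'rV[R]_d) (row i V).
  by rewrite cone_rays_full //; exists i.
by case=> pi fi; split=> //; apply: fan_face fi.
Qed.

(** A section of weight [dual_vec V p] has degree at least [p]; if the degree is
    larger, the section lies in [F_{>p}]. *)
Lemma section_elementsE p e : section_elements E v (p, e) <->
  [/\ degree e = p, polyhedron E e (to_real R (degree_char e)) &
      e \notin flat_above E v p].
Proof.
split=> /=.
  move=> [u [/= pE eu en]]; move: eu; rewrite inE => /asboolP Pu.
  have uE : u = dual_vec V p by rewrite pE dual_vec_pairing.
  have dE : degree e = p.
    apply/eqP/negPn/negP => nep; case/negP: en; rewrite flat_aboveE.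
    apply: (fintype.subsetP (sub_span _)); first by rewrite groundM finset.subsetT.
    rewrite inE nep andbT; apply/forallP => i; have := Pu _ (fan_rays_row i).
    by rewrite pairing_to_real degreeE ler_int pE mxE.
  by split=> //; rewrite /degree_char dE -uE.
move=> [<- Pe en]; exists (degree_char e); split=> //=.
  by apply/rowP => i; rewrite mxE pairing_dual_vec.
by rewrite inE; apply/asboolP.
Qed.

(** The union of the slices of a basis of the fiber does
    not depend on the adapted basis with which the characters are computed, so
    it serves for all lists of characters. *)
Lemma sections_span_fiberE :
  (exists2 A, dsum_basis (matroid_fiber E v) A & (A `<=` section_elements E v)%classic) <->
  (exists2 B : {set 'I_m}, basis M B & forall u : (rank M).-tuple 'cV[int]_d,
     characters_at E (cone_of V) u -> vertices_at E (cone_of V) B u).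
Proof.
have gE := graded_basis_of_slices groundM (@le_row_refl d) (@le_row_trans d) (@le_row_anti d).
have fE p : matroid_fiber E v p = graded_quotient M (@le_row d) degree p.
  by rewrite /graded_quotient /matroid_fiber flat_atE flat_aboveE.
have [B0 aB0] := bundle_linear E Sigma_V; have gB0 := adapted_graded aB0.
split=> [[A /dsum_basisE bA sA] | [B bB chB]].
  pose A_ p := [set e | `[< A (p, e) >]]%SET.
  have degA p e : e \in A_ p -> degree e = p.
    by rewrite inE => /asboolP/sA/section_elementsE[].
  have {}bA p : basis (graded_quotient M (@le_row d) degree p) (A_ p).
    by rewrite -fE.
  exists [set e | e \in A_ (degree e)]%SET; first by have [] := gE _ _ _ gB0 bA degA.
  move=> u /characters_atE[B1 aB1 uE]; apply/vertices_atE; split.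
    by move=> e; rewrite /A_ !finset.in_set => /asboolP/sA/section_elementsE[].
  have [_ peq] := gE _ _ _ (adapted_graded aB1) bA degA.
  apply: perm_trans uE _; rewrite perm_sym !(map_comp (dual_vec V) degree).
  exact: perm_map.
have szB0 : size [seq degree_char b | b <- enum B0] == rank M.
  by rewrite size_map -cardE (card_basis_rank (proj1 gB0)).
have [|PB peq] := (vertices_atE B (Tuple szB0)).1 (chB (Tuple szB0) _).
  by apply/characters_atE; exists B0.
have {}peq : perm_eq [seq degree e | e <- enum B] [seq degree e | e <- enum B0].
  apply: (perm_map_inj (dual_vec_inj unitV)).
  by rewrite -!map_comp perm_sym.
pose A : set ('rV[int]_d * 'I_m) := [set x | x.2 \in B /\ degree x.2 = x.1]%classic.
have AE p : [set e | `[< A (p, e) >]]%SET = [set e in B | degree e == p]%SET.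
  apply/finset.setP => e; rewrite !inE; apply/asboolP/andP => -[eB] ?; split=> //; exact/eqP.
have bA p : basis (matroid_fiber E v p) [set e in B | degree e == p].
  by rewrite fE; apply: (slices_of_basis groundM _ _ _ p gB0 bB peq);
    [exact: le_row_refl | exact: le_row_trans | exact: le_row_anti].
exists A.
  by apply/dsum_basisE => p; rewrite AE.
move=> [p e] [/= eB dE]; apply/section_elementsE; split=> //; first exact: PB.
have /fintype.subsetP/(_ e) := indep_ground (basis_indep (bA p)).
by rewrite !inE eB dE eqxx => /(_ isT)/andP[].
Qed.

End BundleAtCone.

Theorem theorem6p5 (R : realType) (d m r : nat) (Sigma : fan R d)
    (smoothSigma : smooth_fan Sigma) (completeSigma : complete_fan Sigma)
    (M : matroid 'I_m) (groundM : ground M = [set: 'I_m]%SET)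
    (loop_freeM : loop_free M) (rankM : rank M = r)
    (E : tropical_bundle Sigma M) :
  globally_generated E <->
  (forall s : set 'rV[R]_d, maximal_cone Sigma s ->
   exists2 B : {set 'I_m}, basis M B &
     forall u : r.-tuple 'cV[int]_d, characters_at E s u -> vertices_at E s B u).
Proof.
subst r; split=> [gg s maxs | H s maxs v ve].
  have [V uV sV] := maximal_cone_full smoothSigma completeSigma maxs.
  subst s; apply/(sections_span_fiberE E groundM uV maxs.1); apply: (gg _ maxs).
  by split; [apply: row_inj | rewrite cone_rays_full].
have [V [uV sV vV]] := ray_enumeration_full smoothSigma completeSigma maxs ve.
by subst s v; apply/(sections_span_fiberE E groundM uV maxs.1); apply: H.
Qed.
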